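(* Let $R$ be a unital associative ring, $M$ a nonzero finitely generated left $R$-module, $\Omega = \mathbb{Z}^+$, $N = \bigoplus_{\alpha\in\Omega} M_\alpha$ with each $M_\alpha = M$, and $E = \mathrm{End}_R(N)$. Let $\rho$ be a preordering of $\Omega$. Then exactly one of the following holds: (1) $E(\rho) \approx D$; (2) $E(\rho) \approx E$.
   Context: $\mathbb{Z}^+$ is the set of positive integers. Endomorphisms are written on the right of their arguments, so $x(fg)=(xf)g$. Each $M_\alpha$ is identified with the corresponding summand of $N$. For $\alpha\in\Omega$, $\pi_\alpha\in E$ is the projection of $N$ onto $M_\alpha$ along $\bigoplus_{\gamma\neq\alpha} M_\gamma$. A preordering is a reflexive transitive binary relation $\rho\subseteq\Omega\times\Omega$. $E(\rho)\subseteq E$ is the subring consisting of those $f\in E$ such that for all $\alpha,\beta\in\Omega$, $\pi_\alpha f\pi_\beta\neq 0$ implies $(\alpha,\beta)\in\rho$. $D\subseteq E$ is the subring of all $f\in E$ such that $M_\alpha f\subseteq M_\alpha$ for each $\alpha\in\Omega$. For subrings $S_1,S_2\subseteq E$, $S_1\approx S_2$ means that there are finite subsets $U,U'\subseteq E$ such that $S_1\subseteq\langle S_2\cup U\rangle$ and $S_2\subseteq\langle S_1\cup U'\rangle$, where $\langle X\rangle$ is the subring generated by $X$ (equivalently, $\langle S_1\cup U\rangle=\langle S_2\cup U\rangle$ for some finite $U\subseteq E$). *)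

(* Defs.v *)
From HB Require Import structures.
From mathcomp Require Import all_boot all_algebra.
From mathcomp Require Import all_classical.

Set Implicit Arguments.
Unset Strict Implicit.
Unset Printing Implicit Defensive.

Import GRing.Theory.
Local Open Scope classical_set_scope.
Local Open Scope ring_scope.

Definition finitely_generated (R : pzRingType) (M : lmodType R) : Prop :=
  exists (n : nat) (g : 'I_n -> M),
    forall x : M, exists c : 'I_n -> R, x = \sum_(i < n) c i *: g i.

Section DirectSum.
Context (R : pzRingType) (M : lmodType R) (I : choiceType).

Definition fin_supp : {pred (I -> M)} :=
  fun x => `[< finite_set [set i | x i != 0] >].

Lemma fin_supp_submod_closed : submod_closed fin_supp.
Proof.
split.
  apply/asboolP; apply: (sub_finite_set _ (@finite_set0 I)).
  by move=> i /eqP; apply.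
move=> a x y /asboolP xfin /asboolP yfin; apply/asboolP.
have xyfin : finite_set ([set i | x i != 0] `|` [set i | y i != 0]).
  by rewrite finite_setU.
apply: sub_finite_set xyfin => i /=.
have [xi0|] := eqVneq (x i) 0; last by left.
have [yi0|] := eqVneq (y i) 0; last by right.
by rewrite [(_ + _) i](_ : _ = a *: x i + y i)// xi0 yi0 scaler0 addr0 eqxx.
Qed.

HB.instance Definition _ :=
  GRing.isSubmodClosed.Build R (I -> M) fin_supp fin_supp_submod_closed.

(* The direct sum of copies of [M] indexed by [I], as the submodule of finitely
   supported functions in the product [I -> M]. *)
Record dsum : Type := DSum {
  dsum_fun :> I -> M;
  dsum_fin_supp : dsum_fun \in fin_supp }.

HB.instance Definition _ := [isSub for dsum_fun].
HB.instance Definition _ := [Choice of dsum by <:].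
HB.instance Definition _ := [SubChoice_isSubLmodule of dsum by <:].

(* The copy of [M] of index [a], identified with its image in the direct sum. *)
Definition summand (a : I) : set dsum :=
  [set x | forall b, b != a -> x b = 0].

Lemma dsum_proj_fin_supp (a : I) (x : dsum) :
  (fun b => if b == a then x b else 0) \in fin_supp.
Proof.
apply/asboolP; apply: (sub_finite_set _ (@finite_set1 _ a)) => b /=.
by have [//|_ /eqP] := eqVneq b a.
Qed.

Definition dsum_proj (a : I) (x : dsum) : dsum :=
  DSum (dsum_proj_fin_supp a x).

Lemma dsum_proj_linear (a : I) : linear (dsum_proj a).
Proof.
move=> k x y; apply/val_inj/funext => b /=.
rewrite [RHS](_ : _ = k *: (dsum_proj a x b) + dsum_proj a y b)//=.
by case: ifP => // _; rewrite scaler0 addr0.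
Qed.

HB.instance Definition _ (a : I) :=
  GRing.isLinear.Build R dsum dsum *:%R (dsum_proj a) (dsum_proj_linear a).

End DirectSum.

(* The endomorphism ring of a left module.  Endomorphisms act on the right, so
   that [f * g] is [f] followed by [g]. *)
Definition endo (R : pzRingType) (N : lmodType R) : Type := {linear N -> N}.

Section EndoRing.
Context (R : pzRingType) (N : lmodType R).
Implicit Types f g h : endo N.

HB.instance Definition _ := gen_eqMixin (endo N).
HB.instance Definition _ := gen_choiceMixin (endo N).

Lemma endoP f g : f =1 g -> f = g.
Proof.
case: f g => [f [[Df] [Sf]]] [g [[Dg] [Sg]]] /= /funext fg.
move: Df Sf Dg Sg; rewrite fg => Df Sf Dg Sg.
by rewrite (Prop_irrelevance Df Dg) (Prop_irrelevance Sf Sg).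
Qed.

Definition endo_zero : endo N := (\0 : N -> N).
Definition endo_one : endo N := (@idfun N).
Definition endo_opp f : endo N := (\- f).
Definition endo_add f g : endo N := (f \+ g).
Definition endo_mul f g : endo N := (g \o f).

Lemma endo_addA : associative endo_add.
Proof. by move=> f g h; apply: endoP => x; exact: addrA. Qed.
Lemma endo_addC : commutative endo_add.
Proof. by move=> f g; apply: endoP => x; exact: addrC. Qed.
Lemma endo_add0 : left_id endo_zero endo_add.
Proof. by move=> f; apply: endoP => x; exact: add0r. Qed.
Lemma endo_addN : left_inverse endo_zero endo_opp endo_add.
Proof. by move=> f; apply: endoP => x; exact: addNr. Qed.

HB.instance Definition _ :=
  GRing.isZmodule.Build (endo N) endo_addA endo_addC endo_add0 endo_addN.

Lemma endo_mulA : associative endo_mul.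
Proof. by move=> f g h; apply: endoP. Qed.
Lemma endo_mul1 : left_id endo_one endo_mul.
Proof. by move=> f; apply: endoP. Qed.
Lemma endo_mulr1 : right_id endo_one endo_mul.
Proof. by move=> f; apply: endoP. Qed.
Lemma endo_mulDl : left_distributive endo_mul endo_add.
Proof. by move=> f g h; apply: endoP => x; exact: raddfD. Qed.
Lemma endo_mulDr : right_distributive endo_mul endo_add.
Proof. by move=> f g h; apply: endoP. Qed.

HB.instance Definition _ := GRing.Zmodule_isPzRing.Build (endo N)
  endo_mulA endo_mul1 endo_mulr1 endo_mulDl endo_mulDr.

End EndoRing.

Section SubringComparison.
Context (E : pzRingType).

Definition generated_subring (X : set E) : set E :=
  smallest (fun S : set E => subring_closed (mem S)) X.

Definition subring_approx (S1 S2 : set E) : Prop :=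
  exists U U' : set E,
    [/\ finite_set U, finite_set U',
        S1 `<=` generated_subring (S2 `|` U)
      & S2 `<=` generated_subring (S1 `|` U')].

End SubringComparison.

Definition preordering (I : Type) (rho : set (I * I)) : Prop :=
  [/\ forall a, rho (a, a)
    & forall a b c, rho (a, b) -> rho (b, c) -> rho (a, c)].

Section SubringsOfEndomorphisms.
Context (R : pzRingType) (M : lmodType R) (I : choiceType).
Local Notation N := (dsum M I).
Local Notation E := (endo N).

Definition endo_proj (a : I) : E := (dsum_proj a : {linear N -> N}).

Definition preorder_subring (rho : set (I * I)) : set E :=
  [set f | forall a b, endo_proj a * f * endo_proj b != 0 -> rho (a, b)].

Definition diagonal_subring : set E :=
  [set f | forall a, f @` summand a `<=` summand a].

End SubringsOfEndomorphisms.

Arguments endo_proj {R} M {I} a.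
Arguments preorder_subring {R} M {I} rho.
Arguments diagonal_subring {R} M I.

Definition posnat : Type := {n : nat | (0 < n)%N}.
HB.instance Definition _ := Choice.on posnat.

(* Main.v *)
Require Import Defs.
From HB Require Import structures.
From mathcomp Require Import finmap all_boot all_algebra.
From mathcomp Require Import all_classical.

(** Write [N] for the direct sum, [E] for its endomorphism ring and
    [rho(a) = {b | (a, b) \in rho}].  Which alternative holds is decided by the
    set [A] of the indices [a] such that [rho(a)] is infinite.

    An endomorphism of [N] is a matrix.  Its rows are arbitrary and can be
    prescribed independently of each other ([glue]), and since [M] is finitely
    generated each row has finitely many nonzero entries ([endo_row_finite]).
    Any map [q] of the index set induces the endomorphism [push q] that carries
    the copy of [M] of index [a] to that of index [q a]; it may merge infinitely
    many copies.

    - If [A] is infinite, choose distinct [a n \in A] and [x (n, k) \in rho(a n)]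
      so that both [a] and [x] are injective.  Any [f] in [E] is then
      [push a * f' * push c], where [f'] carries out row [n] of [f] from index
      [a n], delivering its [k]-th entry at [x (n, k)], and [c] sends [x (n, k)]
      to [k].  The outer factors do not depend on [f], and [f'] lies in [E(rho)],
      so [E(rho) ~ E] ([approx_full]).

    - If [A] is finite, the rows of [f] in [E(rho)] outside [A] have their
      supports in finite sets that depend on [rho] only.  One fixed endomorphism
      copies each [a] outside [A] to all [(a, b)] with [b \in rho(a)], a diagonal
      one applies the entries of [f], and a third fixed one merges the [(a, b)]
      into [b].  The finitely many remaining rows are finite sums of single
      entries, which are obtained from [D] and two more endomorphisms.  Hence
      [E(rho) ~ D] ([approx_diagonal]).

    - Both cannot hold, for then [E] would be generated by [D] and a finite set
      [U].  Filter [N] by the supports of its elements.  Elements of [D] preserve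
      the filtration, and those of [U] shift it at most by some [phi : nat ->
      nat], so everything generated shifts it at most by an iterate of [phi].
      An endomorphism of the form [push q] outgrows all the iterates
      ([diagonal_not_finitely_extendable]). *)

Set Implicit Arguments.
Unset Strict Implicit.
Unset Printing Implicit Defensive.

Import GRing.Theory.
Local Open Scope classical_set_scope.
Local Open Scope ring_scope.

(** * Endomorphisms of a direct sum as matrices *)

Section DirectSumEndomorphisms.
Context (R : pzRingType) (M : lmodType R) (I : choiceType).
Local Notation N := (dsum M I).
Local Notation E := (endo N).
Implicit Types (a b c d i j : I) (x y : N) (f g : E).

Lemma dsumP x y : (forall i, x i = y i) -> x = y.
Proof. by move=> xy; apply/val_inj/funext. Qed.

Lemma dsum_sumE (J : Type) (s : seq J) (F : J -> N) i :
  (\sum_(j <- s) F j) i = \sum_(j <- s) F j i.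
Proof. exact: (big_morph (fun x : N => x i)). Qed.

Definition supp x : seq I := fset_set [set i | x i != 0].

Lemma in_supp x i : (i \in supp x) = (x i != 0).
Proof.
have xfin : finite_set [set i | x i != 0] by apply/asboolP/(dsum_fin_supp x).
by rewrite /supp in_fset_set//; apply/idP/idP; rewrite inE.
Qed.

Lemma dsum_projE a x b : dsum_proj a x b = if b == a then x b else 0.
Proof. by []. Qed.

Lemma dsum_inj_fin_supp a (m : M) :
  (fun b => if b == a then m else 0) \in @fin_supp R M I.
Proof.
apply/asboolP; apply: (sub_finite_set _ (@finite_set1 _ a)) => b /=.
by have [//|_ /eqP] := eqVneq b a.
Qed.

Definition dsum_inj a (m : M) : N := DSum (dsum_inj_fin_supp a m).

Lemma dsum_inj_linear a : linear (dsum_inj a).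
Proof.
move=> k m n; apply: dsumP => b /=.
rewrite [RHS](_ : _ = k *: dsum_inj a m b + dsum_inj a n b)//=.
by case: ifP => // _; rewrite scaler0 addr0.
Qed.

HB.instance Definition _ a :=
  GRing.isLinear.Build R M N *:%R (dsum_inj a) (dsum_inj_linear a).

(** The matrix unit: the identity of [M] from the copy of index [a] to that of
    index [b], and zero on the other copies. *)
Definition transfer_fun a b x : N := dsum_inj b (x a).

Lemma transfer_linear a b : linear (transfer_fun a b).
Proof. by move=> k x y; rewrite /transfer_fun -linearP. Qed.

HB.instance Definition _ a b :=
  GRing.isLinear.Build R N N *:%R (transfer_fun a b) (transfer_linear a b).

Definition transfer a b : E := (transfer_fun a b : {linear N -> N}).

(** Prescribing an endomorphism row by row, where row [i] is that of [h i]: the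
    universal property of the direct sum in a form internal to [E]. *)
Definition glue_fun (h : I -> E) x : N :=
  \sum_(i <- supp x) h i (dsum_proj i x).

(** The sum may range over any larger support; a common one is what makes
    additivity provable. *)
Lemma glue_funE (h : I -> E) x (s : seq I) : uniq s ->
  (forall i, x i != 0 -> i \in s) ->
  glue_fun h x = \sum_(i <- s) h i (dsum_proj i x).
Proof.
move=> us xs; rewrite [RHS](bigID (fun i => x i != 0))/=.
rewrite [X in _ + X]big1 ?addr0; last first.
  move=> i /negPn/eqP xi0; rewrite (_ : dsum_proj i x = 0) ?raddf0//.
  by apply: dsumP => j; rewrite dsum_projE; case: eqP => // ->.
rewrite -big_filter; apply: perm_big; apply: uniq_perm.
- exact: fset_uniq.
- exact: filter_uniq.
move=> i; rewrite mem_filter in_supp.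
by have [/xs -> //|//] := boolP (x i != 0).
Qed.

Lemma glue_linear h : linear (glue_fun h).
Proof.
move=> k x y.
pose s := undup (supp x ++ supp y).
have us : uniq s by exact: undup_uniq.
have sx i : x i != 0 -> i \in s by rewrite mem_undup mem_cat in_supp => ->.
have sy i : y i != 0 -> i \in s.
  by rewrite mem_undup mem_cat orbC in_supp => ->.
rewrite (glue_funE h us sx) (glue_funE h us sy).
rewrite (@glue_funE _ _ s)//; last first.
  move=> i; apply: contraR => si.
  have /eqP xi0 : x i == 0 by apply: contraR si => /sx.
  have /eqP yi0 : y i == 0 by apply: contraR si => /sy.
  by rewrite -[X in X == 0]/(k *: x i + y i) xi0 yi0 scaler0 addr0.
rewrite scaler_sumr -big_split; apply: eq_bigr => i _ /=.
by rewrite !linearP.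
Qed.

HB.instance Definition _ h :=
  GRing.isLinear.Build R N N *:%R (glue_fun h) (glue_linear h).

Definition glue (h : I -> E) : E := (glue_fun h : {linear N -> N}).

Local Notation e := transfer.

Lemma endo_projE a : endo_proj M a = e a a.
Proof.
apply: endoP => x; apply: dsumP => b /=; rewrite /transfer_fun/=.
by case: eqP => // ->.
Qed.

Lemma transferM a b c d : e a b * e c d = if b == c then e a d else 0.
Proof.
apply: endoP => x; case: eqP => [->|/eqP/negbTE bc].
  by apply: dsumP => i; rewrite /= /transfer_fun/= eqxx.
by rewrite /= /transfer_fun /= eq_sym bc raddf0.
Qed.

Lemma transferM_id a b c : e a b * e b c = e a c.
Proof. by rewrite transferM eqxx. Qed.

Lemma dsum_decomp x : x = \sum_(i <- supp x) dsum_proj i x.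
Proof.
apply: dsumP => j; rewrite dsum_sumE.
have [jx|jx] := boolP (j \in supp x); last first.
  rewrite big_seq big1; first by move: jx; rewrite in_supp negbK => /eqP.
  move=> i ix; rewrite dsum_projE; case: eqP => // ji.
  by move: jx; rewrite ji ix.
rewrite (bigD1_seq j) ?fset_uniq//= eqxx big1 ?addr0// => i ij.
by rewrite eq_sym (negbTE ij).
Qed.

Lemma endo_rowP f g : (forall a, e a a * f = e a a * g) -> f = g.
Proof.
move=> fg; apply: endoP => x; rewrite [x]dsum_decomp !raddf_sum.
apply: eq_bigr => i _; have := congr1 (fun h : E => h x) (fg i).
by rewrite -endo_projE.
Qed.

Lemma endo_col0 f : (forall b, f * e b b = 0) -> f = 0.
Proof.
move=> f0; apply: endoP => x; apply: dsumP => b.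
have := congr1 (fun h : E => h x b) (f0 b).
by rewrite -endo_projE /= eqxx.
Qed.

Lemma transfer_glue h a b : e a b * glue h = e a b * h b.
Proof.
apply: endoP => x /=; rewrite (@glue_funE _ _ [:: b])//= ?big_seq1.
  congr (h b _); apply: dsumP => i /=; by case: eqP.
by move=> i /=; rewrite inE; have [//|_] := eqVneq i b; rewrite eqxx.
Qed.

Definition push (q : I -> I) : E := glue (fun a => e a (q a)).

Lemma transfer_push q a b : e a b * push q = e a (q b).
Proof. by rewrite transfer_glue transferM_id. Qed.

Lemma pushM q r : push q * push r = push (r \o q).
Proof. by apply: endo_rowP => a; rewrite mulrA !transfer_push. Qed.

Lemma push_id : push id = 1.
Proof. by apply: endo_rowP => a; rewrite transfer_push mulr1. Qed.

Lemma push_col0 q b : (forall a, q a != b) -> push q * e b b = 0.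
Proof.
move=> qb; apply: endo_rowP => a.
by rewrite mulrA transfer_push transferM (negbTE (qb a)) mulr0.
Qed.

Lemma push_iter q k : push q ^+ k = push (iter k q).
Proof.
elim: k => [|k IH]; first by rewrite expr0 push_id.
by rewrite exprSr IH pushM.
Qed.

Lemma preorder_subringP (rho : set (I * I)) f :
  preorder_subring M rho f <->
  forall a b, ~ rho (a, b) -> e a a * f * e b b = 0.
Proof.
split=> [fr a b nr|fr a b].
  by apply/eqP/negPn/negP => h; apply/nr/fr; rewrite !endo_projE.
by rewrite !endo_projE => /eqP ne; apply: contrapT => /fr.
Qed.

Lemma diagonal_subringP f :
  diagonal_subring M I f <-> forall a b, a != b -> e a a * f * e b b = 0.
Proof.
split=> [fD a b ab|fD a _ [x xa <-] b ba].
  apply: endoP => x; rewrite -!endo_projE.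
  have: summand a (f (dsum_proj a x)).
    by apply: fD; exists (dsum_proj a x) => // i /negbTE ia; rewrite /= ia.
  move=> h; apply: dsumP => i /=; case: eqP => // ->.
  by rewrite h// eq_sym.
have xax : dsum_proj a x = x.
  by apply: dsumP => i /=; case: eqP => // /eqP /xa ->.
have := congr1 (fun h : E => h x b) (fD a b _).
by rewrite eq_sym -!endo_projE /= eqxx xax; exact.
Qed.

(** A row is the sum of its entries, given a finite set outside of which they
    vanish. *)
Lemma endo_row_sum f a (s : seq I) : uniq s ->
  (forall b, b \notin s -> e a a * f * e b b = 0) ->
  e a a * f = \sum_(b <- s) e a a * f * e b b.
Proof.
move=> us fs; apply/eqP; rewrite -subr_eq0; apply/eqP/endo_col0 => c.
rewrite mulrBl mulr_suml.
have col i : e a a * f * e i i * e c c =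
    if i == c then e a a * f * e c c else 0.
  by rewrite -[LHS]mulrA transferM; case: eqP => [->//|_]; rewrite mulr0.
have [cs|cs] := boolP (c \in s).
  rewrite (bigD1_seq c)//= big1 ?addr0; first by rewrite col eqxx subrr.
  by move=> i ic; rewrite col (negbTE ic).
rewrite fs// big_seq big1 ?subr0// => i si.
by rewrite col; case: eqP => // ic; rewrite -ic si in cs.
Qed.

(** Only the images of finitely many generators of the copy of [M] of index [a]
    contribute to row [a], and each of them has finite support. *)
Lemma endo_row_finite f a : finitely_generated M ->
  exists s : seq I, uniq s /\ forall b, b \notin s -> e a a * f * e b b = 0.
Proof.
move=> [n [g gM]].
pose s := undup (flatten [seq (supp (f (dsum_inj a (g i))) : seq I) | i : 'I_n]).
exists s; split; first exact: undup_uniq.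
move=> b bs; apply: endoP => x; apply: dsumP => j.
rewrite -endo_projE /= /transfer_fun/=; case: eqP => // _.
have -> : dsum_proj a x = dsum_inj a (x a).
  by apply: dsumP => i /=; case: eqP => // ->.
have [c ->] := gM (x a); rewrite !raddf_sum dsum_sumE big1// => i _.
rewrite -[LHS]/((f (dsum_inj a (c i *: g i)) : N) b).
have -> : dsum_inj a (c i *: g i) = c i *: dsum_inj a (g i) by exact: linearZ.
rewrite linearZ.
have /eqP fb0 : f (dsum_inj a (g i)) b == 0.
  rewrite -[_ == 0]negbK -in_supp; apply: contra bs => bi.
  by rewrite mem_undup; apply/flatten_mapP; exists i => //; rewrite mem_enum.
by rewrite -[LHS]/(c i *: f (dsum_inj a (g i)) b) fb0 scaler0.
Qed.

Lemma entry0 f a b x : e a a * f * e b b = 0 -> f (dsum_proj a x) b = 0.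
Proof.
by move/(congr1 (fun h : E => h x b)); rewrite -!endo_projE /= eqxx.
Qed.

Lemma endo_apply0 f b x :
  (forall a, x a != 0 -> f (dsum_proj a x) b = 0) -> f x b = 0.
Proof.
move=> fx; rewrite [x in f x]dsum_decomp raddf_sum dsum_sumE.
by rewrite big_seq big1// => a; rewrite in_supp; exact: fx.
Qed.

End DirectSumEndomorphisms.

(** * Generated subrings *)

Section GeneratedSubring.
Context (E : pzRingType).
Implicit Types X S : set E.

Lemma generated_subring_closed X : subring_closed (mem (generated_subring X)).
Proof.
split.
- by rewrite inE => S [[S1 _ _] _]; move: S1; rewrite inE.
- move=> f g; rewrite !inE => fX gX S SX; have [[_ SB _] _] := SX.
  by have := SB f g; rewrite !inE; apply; [exact: (fX S SX) | exact: (gX S SX)].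
- move=> f g; rewrite !inE => fX gX S SX; have [[_ _ SM] _] := SX.
  by have := SM f g; rewrite !inE; apply; [exact: (fX S SX) | exact: (gX S SX)].
Qed.

(** The boolean form of [generated_subring], on which the closure lemmas for
    subring predicates apply. *)
Definition in_generated X : {pred E} := mem (generated_subring X).

HB.instance Definition _ X :=
  GRing.isSubringClosed.Build E (in_generated X) (generated_subring_closed X).

Lemma in_generatedE X f : generated_subring X f <-> f \in in_generated X.
Proof. by rewrite /in_generated inE. Qed.

Lemma in_generatedW X f : X f -> f \in in_generated X.
Proof. by move=> Xf; apply/in_generatedE => S [_]; exact. Qed.

Lemma generated_subring_min X S :
  subring_closed (mem S) -> X `<=` S -> generated_subring X `<=` S.
Proof. by move=> Sc XS f; apply; split. Qed.

Lemma generated_subring_trans X Y :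
  X `<=` generated_subring Y -> generated_subring X `<=` generated_subring Y.
Proof. by apply: generated_subring_min; exact: generated_subring_closed. Qed.

End GeneratedSubring.

(** * Injective choices *)

(** Handle the indices in the order of their codes, each time avoiding the
    finitely many values used before. *)
Lemma distinct_representatives (J : countType) (T : choiceType)
    (S : J -> set T) : (forall j, infinite_set (S j)) ->
  exists x : J -> T, injective x /\ forall j, S j (x j).
Proof.
move=> Sinf.
have /choice[p pP] : forall js : J * seq T, exists y,
    S js.1 y /\ y \notin js.2.
  move=> -[j s] /=.
  have [y [Sy ys]] := infinite_setN0 (infinite_setD (Sinf j) (finite_seq s)).
  by exists y; split => //; exact/negP.
pose fix used t : seq T := if t is t'.+1 then
  if @unpickle J t' is Some j then p (j, used t') :: used t' else used t'
  else [::].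
pose x j := p (j, used (pickle j)).
have used_mono t u : (t <= u)%N -> {subset used t <= used u}.
  move=> /subnKC <-; elim: (u - t)%N => [|k IH] y yt; first by rewrite addn0.
  by rewrite addnS /=; case: unpickle => [j|]; rewrite ?inE IH ?orbT.
have x_lt i j : (pickle i < pickle j)%N -> x i != x j.
  move=> ij; apply: contraNneq (pP (j, used (pickle j))).2 => /= xij.
  rewrite -[p _]/(x j) -xij; apply: (used_mono _ _ ij).
  by rewrite /= pickleK inE eqxx.
exists x; split=> [i j xij|j]; last exact: (pP (j, _)).1.
apply: (pcan_inj (@pickleK J)).
have [/x_lt|/x_lt|//] := ltngtP (pickle i) (pickle j).
  by rewrite xij eqxx.
by rewrite xij eqxx.
Qed.

Lemma left_inverse_exists (A B : choiceType) (h : A -> B) (a0 : A) :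
  injective h -> exists h', cancel h h'.
Proof.
move=> hI.
have /choice[h' hh'] : forall b, exists a', forall a, h a = b -> a' = a.
  move=> b; have [[a ab]|nb] := pselect (exists a, h a = b).
    by exists a => a' ; rewrite -ab => /hI.
  by exists a0 => a ab; case: nb; exists a.
by exists h' => a; exact: hh'.
Qed.

(** * The two equivalences *)

Section Dichotomy.
Context (R : pzRingType) (M : lmodType R) (I : countType).
Local Notation N := (dsum M I).
Local Notation E := (endo N).
Local Notation D := (diagonal_subring M I).
Local Notation e := (@transfer R M I).
Implicit Types (a b c i j : I) (x y : N) (f g : E).

Lemma diagonal_sub_preorder (rho : set (I * I)) :
  preordering rho -> D `<=` preorder_subring M rho.
Proof.
move=> [rho_refl _] f /diagonal_subringP fD; apply/preorder_subringP => a b nr.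
by apply: fD; apply: contra_notN nr => /eqP ->.
Qed.

(** This moves the entry of [f] at [(a, b)] to the diagonal, at index [b]. *)
Lemma diagonal_corner f a b : D (e b a * f * e b b).
Proof.
apply/diagonal_subringP => i j ij; rewrite !mulrA transferM.
case: eqP => [ib|]; last by rewrite !mul0r.
by rewrite -mulrA transferM -ib (negbTE ij) mulr0.
Qed.

Lemma diagonal_glue (h : I -> E) : D (glue (fun a => e a a * h a * e a a)).
Proof.
apply/diagonal_subringP => i j ij; rewrite transfer_glue !mulrA transferM_id.
by rewrite -mulrA transferM (negbTE ij) mulr0.
Qed.

(** In the proof, [push a] moves row [n] to the index [a n]; from there
    [E(rho)] can spread any finite row over the infinitely many places
    [x (n, k)], which no other row uses, so that a single [push] undoes the
    relabelling of all the rows at once. *)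
Lemma approx_full (rho : set (I * I)) (i0 : I) :
  infinite_set [set a | infinite_set [set b | rho (a, b)]] ->
  subring_approx (preorder_subring M rho) [set: E].
Proof.
move=> Ainf.
have [a [aI aA]] := distinct_representatives (fun _ : I => Ainf).
have [x [xI xr]] := distinct_representatives (fun nk : I * I => aA nk.1).
have [a' aK] := left_inverse_exists i0 aI.
have [x' xK] := left_inverse_exists (i0, i0) xI.
exists set0, [set` [:: push M a; push M (fun j => (x' j).2)]].
split; [exact: finite_set0 | exact: finite_seq | |].
  by move=> f _; apply/in_generatedE/in_generatedW; left.
move=> f _.
(* The test holds when [b] is a value of [a]; row [a' b] of [f] then starts
   from [b]. *)
pose h b : E := if a (a' b) == b then
  e b (a' b) * f * push M (fun k => x (a' b, k)) else 0.
have -> : f = push M a * glue h * push M (fun j => (x' j).2).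
  apply: endo_rowP => n; rewrite !mulrA transfer_push transfer_glue /h aK eqxx.
  rewrite !mulrA transferM_id -[RHS]mulrA pushM.
  rewrite (_ : _ \o _ = id); last by apply/funext => k /=; rewrite xK.
  by rewrite push_id mulr1.
have gr : preorder_subring M rho (glue h).
  apply/preorder_subringP => b j nr; rewrite transfer_glue /h.
  case: eqP => [ab|]; last by rewrite mulr0 mul0r.
  rewrite !mulrA -mulrA push_col0 ?mulr0// => k.
  apply: contra_notN nr => /eqP <-; have := xr (a' b, k).
  by rewrite /= ab.
apply/in_generatedE; rewrite !rpredM//; apply: in_generatedW.
- by right; rewrite /= inE eqxx.
- by left.
- by right; rewrite /= !inE eqxx orbT.
Qed.

(** The map [next] enumerates the index set from [i0], so that a power of
    [push next] reaches any column: this gives the entries of the finitely many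
    rows for which [rho] imposes no finite support.  The other rows are treated
    together by [spread] and [collapse], which route each pair [(a, b)] through
    an index of its own, coded by [p]. *)
Lemma approx_diagonal (rho : set (I * I)) (i0 : I) (next : I -> I) :
  finitely_generated M -> preordering rho ->
  infinite_set [set: I] -> (forall i, exists k, iter k next i0 = i) ->
  finite_set [set a | infinite_set [set b | rho (a, b)]] ->
  subring_approx (preorder_subring M rho) D.
Proof.
move=> M_fg rhoP Iinf nextP Ffin.
have [p [pI _]] := distinct_representatives (fun _ : I * I => Iinf).
have [p' pK] := left_inverse_exists (i0, i0) pI.
pose row a : seq I := fset_set [set b | rho (a, b)].
(* On an infinite set [fset_set] is empty, so that [spread] kills the rows that
   are to be handled one entry at a time. *)
pose spread : E := glue (fun a => \sum_(b <- row a) e a (p (a, b))).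
pose collapse := push M (fun c => (p' c).2).
exists [set` [:: spread; collapse; push M (fun=> i0); push M next]], set0.
split; [exact: finite_seq | exact: finite_set0 | | ]; last first.
  move=> f Df; apply/in_generatedE/in_generatedW; left.
  exact: diagonal_sub_preorder.
move=> f /preorder_subringP fr; apply/in_generatedE.
set X := _ `|` _.
have XD d : D d -> d \in in_generated X by move=> ?; apply: in_generatedW; left.
have [Xspread Xcollapse Xpush0 Xnext] : [/\ spread \in in_generated X,
    collapse \in in_generated X, push M (fun=> i0) \in in_generated X
    & push M next \in in_generated X].
  by split; apply: in_generatedW; right; rewrite /= !inE eqxx ?orbT.
have Xentry a b : e a a * f * e b b \in in_generated X.
  have [k kb] := nextP b.
  have -> : e a a * f * e b b =
      e a a * push M (fun=> i0) * push M next ^+ k * (e b a * f * e b b).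
    rewrite transfer_push push_iter transfer_push kb.
    by rewrite !mulrA transferM_id.
  apply: rpredM; last exact/XD/diagonal_corner.
  rewrite rpredM ?rpredX// rpredM//.
  by apply: XD; have := @diagonal_corner 1 a a; rewrite mulr1 transferM_id.
have Xrow a : e a a * f \in in_generated X.
  have [s [us sP]] := endo_row_finite f a M_fg.
  by rewrite (endo_row_sum us sP); apply: rpred_sum => b _; exact: Xentry.
pose d : E := glue (fun c =>
  e c c * (e c (p' c).1 * f * e (p' c).2 c) * e c c).
pose F : seq I := fset_set [set a | infinite_set [set b | rho (a, b)]].
have -> : f = \sum_(a <- F) e a a * f + spread * d * collapse.
  apply: endo_rowP => c; rewrite mulrDr mulr_sumr.
  have FE : (c \in F) = `[< infinite_set [set b | rho (c, b)] >].
    by rewrite in_fset_set//; apply/idP/asboolP; rewrite inE.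
  have -> : e c c * (spread * d * collapse) =
      \sum_(b <- row c) e c c * f * e b b.
    rewrite !mulrA transfer_glue mulr_sumr !mulr_suml; apply: eq_bigr => b _.
    rewrite transferM_id transfer_glue pK -!mulrA transfer_push pK.
    by rewrite !mulrA !transferM_id -!mulrA ?transferM_id.
  have [cF|cF] := boolP (c \in F).
    rewrite (bigD1_seq c) ?fset_uniq//= mulrA transferM_id.
    rewrite big1 ?addr0; last first.
      by move=> a ac; rewrite mulrA transferM eq_sym (negbTE ac) mul0r.
    rewrite /row /fset_set; case: pselect => [cfin|_]; last first.
      by rewrite big_nil addr0.
    by move: cF; rewrite FE => /asboolP.
  have cfin : finite_set [set b | rho (c, b)].
    by apply: contrapT => cinf; move/negP: cF; apply; rewrite FE; exact/asboolP.
  rewrite big_seq big1 ?add0r; last first.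
    move=> a aF; rewrite mulrA transferM; case: eqP => [ca|]; last by rewrite mul0r.
    by rewrite ca aF in cF.
  apply: endo_row_sum => [|b]; first exact: fset_uniq.
  rewrite in_fset_set// => /negP nb; apply: fr => rb; apply: nb.
  by rewrite inE.
apply: rpredD; first by apply: rpred_sum => a _; exact: Xrow.
by apply: rpredM => //; apply: rpredM => //; exact/XD/diagonal_glue.
Qed.

(** * The diagonal subring is not equivalent to the full ring *)

(** An increasing filtration of [N] by submodules that involve only finitely
    many copies of [M]. *)
Definition bounded n x := forall i, (n < pickle i)%N -> x i = 0.

(** A level of the filtration involves finitely many rows of [f], each with
    finite support. *)
Lemma endo_bounded f n : finitely_generated M ->
  exists m, forall x, bounded n x -> bounded m (f x).
Proof.
move=> M_fg.
have [s sP] := choice (fun a => endo_row_finite f a M_fg).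
exists (\max_(k < n.+1) oapp (fun i => \max_(j <- s i) pickle j) 0 (unpickle k)).
move=> x xn j jm; apply: endo_apply0 => i xi; apply: entry0.
apply: (sP i).2; apply: contraTN jm => js; rewrite -leqNgt.
have ni : (pickle i < n.+1)%N.
  by rewrite ltnS leqNgt; apply: contraNN xi => /xn ->.
apply: leq_trans (leq_bigmax (Ordinal ni)); rewrite /= pickleK /=.
exact: leq_bigmax_seq.
Qed.

Lemma diagonal_bounded f n x : D f -> bounded n x -> bounded n (f x).
Proof.
move=> /diagonal_subringP fD xn j nj; apply: endo_apply0 => i xi.
apply: entry0; apply: fD; apply: contraNneq xi => ->.
by rewrite xn.
Qed.

(** The map [q] diagonalizes against the iterates of [phi]: it sends the index
    of code [n] beyond [iter n phi n], hence beyond [iter k phi n] as soon as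
    [k <= n]. *)
Lemma diagonal_not_finitely_extendable (U : set E) :
  (exists m : M, m != 0) -> finitely_generated M -> infinite_set [set: I] ->
  finite_set U -> ~ [set: E] `<=` generated_subring (D `|` U).
Proof.
move=> [m m0] M_fg Iinf /finite_seqP[us ->] full.
have /choice[mu muP] : forall fn : E * nat, exists t, forall x,
    bounded fn.2 x -> bounded t (fn.1 x).
  by move=> [f n]; exact: endo_bounded.
(* The summand [n] makes the iterates of [phi] pointwise nondecreasing. *)
pose phi n := (n + \sum_(f <- us) mu (f, n))%N.
pose S := [set f : E |
  exists k, forall n x, bounded n x -> bounded (iter k phi n) (f x)].
have bounded_le n l x : (n <= l)%N -> bounded n x -> bounded l x.
  by move=> nl xn i li; apply: xn; exact: leq_ltn_trans nl li.
have phi_ge n k l : (k <= l)%N -> (iter k phi n <= iter l phi n)%N.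
  move=> /subnKC <-; elim: (l - k)%N => [|t IH]; first by rewrite addn0.
  by rewrite addnS /=; apply: leq_trans IH _; rewrite leq_addr.
have Sc : subring_closed (mem S).
  split=> [|f g|f g].
  - by rewrite inE; exists 0%N.
  - rewrite !inE => -[k fk] [l gl]; exists (maxn k l) => n x xn j lj.
    rewrite -[LHS]/(f x j - g x j).
    rewrite (bounded_le _ _ _ _ (fk n x xn) j lj) ?phi_ge ?leq_maxl//.
    by rewrite (bounded_le _ _ _ _ (gl n x xn) j lj) ?phi_ge ?leq_maxr// subr0.
  - rewrite !inE => -[k fk] [l gl]; exists (l + k)%N => n x xn.
    by rewrite iterD; apply: gl; exact: fk.
have XS : D `|` [set` us] `<=` S.
  move=> f [fD|/= fus].
    by exists 0%N => n x; exact: diagonal_bounded.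
  exists 1%N => n x /(muP (f, n)) /=; apply: bounded_le.
  by rewrite /phi (big_rem f)//= addnCA leq_addr.
have far t : exists j : I, (t < pickle j)%N.
  apply: contrapT => near; apply: Iinf.
  pose s := iota 0 t.+1.
  apply: sub_finite_set (finite_seq (pmap unpickle s)) => j _.
  rewrite -[_ j]/(is_true (j \in _)) mem_pmap -(pickleK j).
  apply: map_f; rewrite mem_iota add0n ltnS /= leqNgt.
  by apply/negP => tj; apply: near; exists j.
have [q qP] := choice (fun i : I => far (iter (pickle i) phi (pickle i))).
have [k qk] : S (push M q) by apply: (generated_subring_min Sc XS); exact: full.
have [i ki] : exists i, (k <= pickle i)%N.
  by have [i /ltnW] := far k; exists i.
have im : bounded (pickle i) (dsum_inj i m).
  by move=> j ij /=; case: eqP ij => // ->; rewrite ltnn.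
have := qk _ _ im (q i) (leq_ltn_trans (phi_ge _ _ _ ki) (qP i)).
have := congr1 (fun h : E => h (dsum_inj i m) (q i)) (transfer_push M q i i).
rewrite -endo_projE /= /transfer_fun /= !eqxx.
have -> : dsum_proj i (dsum_inj i m) = dsum_inj i m.
  by apply: dsumP => j /=; case: eqP.
by move=> -> /eqP; rewrite (negbTE m0).
Qed.

End Dichotomy.

(** * The positive integers *)

HB.instance Definition _ := Countable.on posnat.

Definition posnat_one : posnat := exist _ 1%N isT.
Definition posnat_succ (n : posnat) : posnat := exist _ (val n).+1 isT.

Lemma posnat_iter (n : posnat) : exists k, iter k posnat_succ posnat_one = n.
Proof.
have valE k : val (iter k posnat_succ posnat_one) = k.+1.
  by elim: k => [//|k IH]; rewrite iterS /= IH.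
by exists (val n).-1; apply: val_inj; rewrite valE prednK//; exact: (valP n).
Qed.

Lemma infinite_posnat : infinite_set [set: posnat].
Proof.
move=> /(finite_image (fun n : posnat => (val n).-1)) fin; apply: infinite_nat.
by apply: sub_finite_set fin => n _; exists (exist _ n.+1 isT).
Qed.

Theorem theorem23 (R : pzRingType) (M : lmodType R)
    (M_nonzero : exists m : M, m != 0) (M_fg : finitely_generated M)
    (rho : set (posnat * posnat)) (rho_preordering : preordering rho) :
  let E := endo (dsum M posnat) in
  let E_rho : set E := preorder_subring M rho in
  let D : set E := diagonal_subring M posnat in
  let P1 := subring_approx E_rho D in
  let P2 := subring_approx E_rho [set: E] in
  (P1 \/ P2) /\ ~ (P1 /\ P2).
Proof.
move=> E E_rho D P1 P2; split.
  have [Afin|Ainf] :=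
    pselect (finite_set [set a | infinite_set [set b | rho (a, b)]]).
  - left; exact: (approx_diagonal M_fg rho_preordering infinite_posnat
      posnat_iter Afin).
  - right; exact: (approx_full M posnat_one Ainf).
move=> [[U [_ [Ufin _ rhoD _]]] [_ [V [_ Vfin _ fullrho]]]].
have UVfin : finite_set (U `|` V) by rewrite finite_setU.
apply: (diagonal_not_finitely_extendable M_nonzero M_fg infinite_posnat UVfin).
apply: subset_trans fullrho _; apply: generated_subring_trans => f [frho|Vf].
  apply: (generated_subring_trans _ (rhoD f frho)) => g [Dg|Ug].
    by apply/in_generatedE/in_generatedW; left.
  by apply/in_generatedE/in_generatedW; right; left.
by apply/in_generatedE/in_generatedW; right; right.
Qed.
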